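(* Let $\Gamma=(X,R)$ be a bipartite distance-regular graph with diameter $D\ge 4$, valency $k\ge 3$ and eigenvalues $\theta_0>\theta_1>\cdots>\theta_D$. Put $d=\lfloor D/2\rfloor$, fix $x\in X$ and let $T=T(x)$. Choose $n\in\{1,d\}$ if $D$ is odd, and let $n=1$ if $D$ is even. Let $W$ be a thin irreducible $T$-module with endpoint $2$ and local eigenvalue $\tilde\theta_n=-1-\dfrac{b_2b_3}{\theta_n^2-b_2}$. Let $v$ be a nonzero vector in $E_2^*W$. With respect to the basis $E_{i+2}^*A_iv$ $(0\le i\le D-4)$ of $W$, the matrix representing $A$ is the $(D-3)\times(D-3)$ tridiagonal matrix $$\begin{pmatrix}0&\omega_1&&&&\mathbf 0\\ c_1&0&\omega_2&&&\\ &c_2&\cdot&\cdot&&\\ &&\cdot&\cdot&\cdot&\\ &&&\cdot&\cdot&\omega_{D-4}\\ \mathbf 0&&&&c_{D-4}&0\end{pmatrix},$$ where $$\omega_i=\frac{b_{i+1}c_{i+2}}{c_i}\,\frac{p_{i-1}(\theta_n)\,p_{i+2}(\theta_n)}{p_i(\theta_n)\,p_{i+1}(\theta_n)}\qquad(1\le i\le D-4)$$ (the denominators are nonzero).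
   Context: Graphs are finite, undirected, connected, without loops or multiple edges; $\partial$ denotes path-length distance. A graph $\Gamma=(X,R)$ of diameter $D$ is distance-regular if for all $0\le h,i,j\le D$ and all $x,y\in X$ with $\partial(x,y)=h$ the number $p^h_{ij}=|\{z\in X:\partial(x,z)=i,\ \partial(z,y)=j\}|$ depends only on $h,i,j$. Write $c_i=p^i_{1,i-1}$ $(1\le i\le D)$, $b_i=p^i_{1,i+1}$ $(0\le i\le D-1)$, $k=b_0$ (the valency). $\Gamma$ is bipartite if $X$ can be partitioned into two subsets neither of which contains an edge. For $0\le i\le D$, $A_i\in\mathrm{Mat}_X(\mathbb C)$ is the $i$th distance matrix: its $(y,z)$ entry is $1$ if $\partial(y,z)=i$ and $0$ otherwise; $A=A_1$ is the adjacency matrix. The distinct eigenvalues of $A$ are $\theta_0>\cdots>\theta_D$ (real). For bipartite $\Gamma$ with $D\ge4$, $\theta_1^2>b_2>\theta_d^2$. Let $V=\mathbb C^X$. Polynomials: $f_0,\ldots,f_D\in\mathbb R[\lambda]$ are defined by $f_{-1}=0$, $f_0=1$ and $\lambda f_i=b_{i-1}f_{i-1}+c_{i+1}f_{i+1}$ for $0\le i\le D-1$. For $0\le i\le D$, $p_i=f_0+f_2+\cdots+f_i$ if $i$ is even and $p_i=f_1+f_3+\cdots+f_i$ if $i$ is odd. For fixed $x\in X$, $E_i^*=E_i^*(x)$ is the diagonal matrix in $\mathrm{Mat}_X(\mathbb C)$ with $(y,y)$ entry $1$ if $\partial(x,y)=i$ and $0$ otherwise. $T=T(x)$ is the subalgebra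 of $\mathrm{Mat}_X(\mathbb C)$ generated by $A,E_0^*,\ldots,E_D^*$. A $T$-module is a subspace $W\subseteq V$ with $BW\subseteq W$ for all $B\in T$; it is irreducible if it is nonzero and contains no $T$-modules other than $0$ and $W$. The endpoint of an irreducible $W$ is $\min\{i:E_i^*W\ne0\}$; $W$ is thin if $\dim E_i^*W\le1$ for $0\le i\le D$. If $W$ is thin irreducible with endpoint $2$, then $E_2^*W$ is a one-dimensional eigenspace for $E_2^*A_2E_2^*$; the corresponding eigenvalue is called the local eigenvalue of $W$. Under the hypotheses of the claim, the vectors $w_i=E_{i+2}^*A_iv$ $(0\le i\le D-4)$ form a basis of $W$. Convention: the matrix $B$ representing $A$ with respect to this basis satisfies $Aw_j=\sum_iB_{ij}w_i$; that is, $Aw_i=c_{i+1}w_{i+1}+\omega_iw_{i-1}$, with out-of-range terms zero. *)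

(* Defs.v *)
From HB Require Import structures.
From mathcomp Require Import all_boot all_order all_algebra.
From mathcomp Require Import reals complex.

Set Implicit Arguments.
Unset Strict Implicit.
Unset Printing Implicit Defensive.

Import Order.TTheory GRing.Theory Num.Theory.

Local Open Scope ring_scope.
Local Open Scope complex_scope.

Section Graph.

Variables (X : finType) (e : rel X).

Definition simple_graph := symmetric e /\ irreflexive e.

Definition connected := forall y z, connect e y z.

Definition bipartite := exists U : {set X},
  {in U &, forall y z, ~~ e y z} /\ {in ~: U &, forall y z, ~~ e y z}.

Definition walk (n : nat) (y z : X) : bool :=
  [exists s : n.-tuple X, path e y s && (last y s == z)].

(* Length of a shortest walk from y to z; a shortest walk has fewer than #|X|
   edges, and the junk value #|X| occurs only if z is not reachable from y. *)
Definition dist (y z : X) : nat := find (fun n => walk n y z) (iota 0 #|X|).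

Definition diameter : nat := \max_(y : X) \max_(z : X) dist y z.

Definition inter_count (i j : nat) (y z : X) : nat :=
  #|[set u | (dist y u == i) && (dist u z == j)]|.

Definition distance_regular := forall h i j : nat,
  (h <= diameter)%N -> (i <= diameter)%N -> (j <= diameter)%N ->
  forall y z y' z' : X, dist y z = h -> dist y' z' = h ->
  inter_count i j y z = inter_count i j y' z'.

(* The intersection number p^h_{ij}, read off an arbitrary pair at distance h:
   meaningful for a distance-regular graph and 0 <= h, i, j <= D. *)
Definition inter_num (h i j : nat) : nat :=
  if [pick yz : X * X | dist yz.1 yz.2 == h] is Some yz
  then inter_count i j yz.1 yz.2 else 0%N.

Definition c_ (i : nat) : nat := inter_num i 1 i.-1.
Definition b_ (i : nat) : nat := inter_num i 1 i.+1.
Definition valency : nat := b_ 0.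

Section Polynomials.

Variable R : realType.

(* The solution of 'X * f_i = b_{i-1} f_{i-1} + c_{i+1} f_{i+1} with f_{-1} = 0
   and f_0 = 1; only the f_i with i <= D are meaningful, as c_i > 0 holds for
   1 <= i <= D. *)
Fixpoint f_ (i : nat) : {poly R} :=
  if i is j.+1 then
    (c_ j.+1)%:R^-1 *:
      ('X * f_ j - (if j is l.+1 then (b_ l)%:R *: f_ l else 0))
  else 1.

Definition p_ (i : nat) : {poly R} := \sum_(j < i.+1 | odd j == odd i) f_ j.

Definition omega (t : R) (i : nat) : R :=
  (b_ i.+1)%:R * (c_ i.+2)%:R / (c_ i)%:R
  * ((p_ i.-1).[t] * (p_ i.+2).[t] / ((p_ i).[t] * (p_ i.+1).[t])).

Definition theta_tilde (t : R) : R :=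
  - 1 - (b_ 2)%:R * (b_ 3)%:R / (t ^+ 2 - (b_ 2)%:R).

End Polynomials.

Section Terwilliger.

Variable R : realType.

(* Mat_X(C) and C^X are 'M_#|X| and 'cV_#|X|, with the vertex y at index
   enum_rank y. *)
Local Notation Mat := 'M[R[i]]_#|X|.
Local Notation V := 'cV[R[i]]_#|X|.

Definition dist_mx (i : nat) : Mat :=
  \matrix_(r, s) (dist (enum_val r) (enum_val s) == i)%:R.

Definition adj_mx : Mat := dist_mx 1.

Definition ordered_eigenvalues (theta : nat -> R) :=
  (forall i j : nat, (i < j)%N -> (j <= diameter)%N -> theta j < theta i) /\
  (forall a : R[i],
     eigenvalue adj_mx a <-> exists2 i : nat, (i <= diameter)%N & a = (theta i)%:C).

Variable x : X.

Definition dual_idem (i : nat) : Mat :=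
  \matrix_(r, s) ((r == s) && (dist x (enum_val r) == i))%:R.

(* Membership in the algebra T(x). *)
Inductive terwilliger : Mat -> Prop :=
| terw_adj : terwilliger adj_mx
| terw_dual (i : nat) of (i <= diameter)%N : terwilliger (dual_idem i)
| terw_one : terwilliger 1%:M
| terw_add B C of terwilliger B & terwilliger C : terwilliger (B + C)
| terw_scale a B of terwilliger B : terwilliger (a *: B)
| terw_mul B C of terwilliger B & terwilliger C : terwilliger (B *m C).

Definition T_module (W : {vspace V}) :=
  forall B : Mat, terwilliger B -> forall u : V, u \in W -> B *m u \in W.

Definition irreducible_T_module (W : {vspace V}) :=
  [/\ T_module W, W != 0%VS &
      forall U : {vspace V}, T_module U -> (U <= W)%VS -> U = 0%VS \/ U = W].

(* The subspace E_i^* W. *)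
Definition dual_img (i : nat) (W : {vspace V}) : {vspace V} :=
  (linfun (mulmx (dual_idem i)) @: W)%VS.

(* The least i <= D with E_i^* W nonzero, or D + 1 if there is none (W = 0). *)
Definition endpoint (W : {vspace V}) : nat :=
  find (fun i => dual_img i W != 0%VS) (iota 0 diameter.+1).

Definition thin (W : {vspace V}) :=
  forall i : nat, (i <= diameter)%N -> (\dim (dual_img i W) <= 1)%N.

(* For W thin irreducible with endpoint 2, where E_2^* W is a line. *)
Definition has_local_eigenvalue (W : {vspace V}) (a : R[i]) :=
  forall u : V, u \in dual_img 2 W ->
    (dual_idem 2 *m dist_mx 2 *m dual_idem 2) *m u = a *: u.

Definition w_ (v : V) (i : nat) : V := dual_idem i.+2 *m (dist_mx i *m v).

Definition w_tuple (m : nat) (v : V) : m.-tuple V := [tuple w_ v i | i < m].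

(* B represents the action of M in the basis w of W: M w_j = sum_i B_ij w_i. *)
Definition represents (m : nat) (W : {vspace V}) (w : m.-tuple V)
    (M : Mat) (B : 'M[R[i]]_m) :=
  basis_of W w /\
  forall j : 'I_m, M *m tnth w j = \sum_(i < m) B i j *: tnth w i.

(* Rows and columns are numbered from 0. *)
Definition tridiag_mx (m : nat) (t : R) : 'M[R[i]]_m :=
  \matrix_(i, j)
    if i == j.+1 :> nat then (c_ j.+1)%:R
    else if j == i.+1 :> nat then (omega t j)%:C
    else 0.

End Terwilliger.

End Graph.

(* Main.v *)
Require Import Defs.
From HB Require Import structures.
From mathcomp Require Import all_boot all_order all_algebra.
From mathcomp Require Import reals complex polyrcf ring lra zify.

Set Implicit Arguments.
Unset Strict Implicit.
Unset Printing Implicit Defensive.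

Import Order.TTheory GRing.Theory Num.Theory.

Local Open Scope ring_scope.
Local Open Scope complex_scope.

(** Write [A_j] for the distance matrices and [E_i] for the projection onto the
    vertices at distance [i] from [x].  Since [v] lives on level 2 and the graph
    is bipartite, [A_j v] lives on the levels [j - 2], [j] and [j + 2]; so level
    [i + 2] carries the three vectors [w_i = E_{i+2} A_i v], [E_{i+2} A_{i+2} v]
    and [E_{i+2} A_{i+4} v].  Their sum is [E_{i+2} J v], which is zero because
    [E_0 W = 0] ([level_sum]).  Reading [A A_j = b_{j-1} A_{j-1} + c_{j+1} A_{j+1}]
    level by level relates the three families ([raise_w], [middle_recurrence],
    [outer_recurrence]).

    By thinness the last two vectors are [(g_i - 1) w_i] and [- g_i w_i] for a
    scalar [g_i] as soon as [w_i] is nonzero.  The relations then say that [A]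
    lowers [w_{i+1}] to [omega_{i+1} w_i], where [omega_{i+1}] is an affine
    function of [g_i] and [g_{i-1}], and that [g_{i+1} omega_{i+1} = b_{i+4} g_i];
    the local eigenvalue is [g_0 - 1].  Hence everything is determined by [g_0].
    With [t p_i = b_{i+1} p_{i-1} + c_{i+1} p_{i+1}] one checks that the solution
    is [g_i = - (b_{i+2} b_{i+3} / (c_{i+1} c_{i+2})) p_i / p_{i+2}] ([outer_coef])
    together with the announced [omega_i], the polynomials being evaluated at
    [t = theta_n].  This is the induction [w_chain]: as long as [omega_{i+1}] is
    nonzero, so is [w_{i+1}].  It reaches [w_{D-4}] because [p_i] does not vanish
    at [theta_n] for [i <= D - 2]; and [w_{D-3} = 0], since [p_{D-1}] does vanish
    there, so that [A] lowers [w_{D-3}] to 0, and a vector that is raised from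
    [w_{D-4}] and lowered to 0 is orthogonal to itself.  The span of the [w_i] is
    therefore stable under [A] and the [E_i], and equals [W] by irreducibility.

    It remains to locate [theta_n] among the roots of the [p_i].  As
    [f_j(A) = A_j] and [p_D + p_{D-1}] is the sum of all [f_j], every eigenvalue
    other than [k] is a root of [p_D + p_{D-1}]; combined with
    [t p_{D-1} = k p_D] this makes [theta_1, ..., theta_{D-1}] roots of [p_{D-1}],
    and by degree there are no others ([root_predP]).  Finally the signs of the
    [p_i] are followed from [k] down to [theta_1], or from 0 up to [theta_d]:
    on the way [p_{D-1}] has no root, and by the three-term recurrence no other
    [p_i] can be the first one to reach 0 ([sign_barrier]). *)

(** * Families of polynomials with persistent signs *)

Section SignBarrier.

Variable R : rcfType.

Lemma poly_ge0_no_root (g : {poly R}) a b :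
  0 < g.[a] -> (forall t, a < t < b -> ~~ root g t) ->
  forall t, a <= t <= b -> 0 <= g.[t].
Proof.
move=> ga nr t /andP[le_at le_tb]; rewrite leNgt; apply/negP => gt0.
have [|u] := @poly_ivtoo _ g a t le_at; first by rewrite pmulr_rlt0.
rewrite in_itv /= => /andP[lt_au lt_ut] /idP; apply/negP/nr.
by rewrite lt_au (lt_le_trans lt_ut).
Qed.

(** A first zero of the family along [[a, b]] would be a point where all members
    are still nonnegative and one of them vanishes; this is what the barrier
    hypothesis excludes. *)
Lemma sign_barrier m (g : nat -> {poly R}) a b : a <= b ->
    (forall i, (i < m)%N -> 0 < (g i).[a]) ->
    (forall t, a < t <= b -> (forall i, (i < m)%N -> 0 <= (g i).[t]) ->
       forall i, (i < m)%N -> (g i).[t] != 0) ->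
  forall i, (i < m)%N -> 0 < (g i).[b].
Proof.
move=> le_ab pos_a barrier.
have [<- //|neq_ab] := eqVneq a b.
have lt_ab : a < b by rewrite lt_neqAle neq_ab.
pose P := \prod_(i < m) g i.
have P_root t i : (i < m)%N -> root (g i) t -> root P t.
  move=> lt_i r; rewrite /root /P horner_prod.
  by apply/prodf_eq0; exists (Ordinal lt_i).
have pos c : a < c <= b -> {in `]a, c[, forall z, ~~ root P z} ->
    forall i, (i < m)%N -> 0 < (g i).[c].
  move=> /andP[lt_ac le_cb] nr.
  have ge0 i : (i < m)%N -> 0 <= (g i).[c].
    move=> lt_i; apply: (poly_ge0_no_root (b := c) (pos_a i lt_i)); last first.
      by rewrite lexx ltW.
    move=> t t_ac; apply: contra (nr t _); first exact: P_root lt_i.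
    by rewrite in_itv.
  move=> i lt_i; rewrite lt_neqAle ge0 // eq_sym barrier //.
  by rewrite lt_ac.
case: (next_rootP P a b) => [P0|y _ Py y_ab nr|c _ _ nr].
- have : 0 < P.[a] by rewrite /P horner_prod prodr_gt0 // => i _; apply: pos_a.
  by rewrite P0 horner0 ltxx.
- move: y_ab; rewrite in_itv /= => /andP[lt_ay lt_yb].
  have : 0 < P.[y].
    rewrite /P horner_prod prodr_gt0 // => i _; apply: pos => //.
    by rewrite lt_ay ltW.
  by rewrite Py ltxx.
- by apply: pos => //; rewrite lt_ab lexx.
Qed.

End SignBarrier.

Lemma sum_ord_eq (V : nmodType) n a (F : nat -> V) :
  \sum_(i < n) (if i == a :> nat then F i else 0) = if (a < n)%N then F a else 0.
Proof.
case: ltnP => [lt_an|le_na].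
  rewrite (bigD1 (Ordinal lt_an)) //= eqxx big1 ?addr0 // => j.
  by rewrite -val_eqE /= => /negPf->.
by rewrite big1 // => j _; rewrite ltn_eqF // (leq_trans (ltn_ord j)).
Qed.

(** * The three-term recurrence of the polynomials p *)

Section Recurrence.

Variables (R : realType) (X : finType) (e : rel X) (D : nat).
Local Notation b i := ((b_ e i)%:R : R).
Local Notation c i := ((c_ e i)%:R : R).
Local Notation k := ((valency e)%:R : R).
Local Notation f := (f_ e R).
Local Notation p := (p_ e R).

Hypothesis bc_sum : forall i, (i <= D)%N -> (b_ e i + c_ e i = valency e)%N.
Hypothesis c_pos : forall i, (0 < i <= D)%N -> (0 < c_ e i)%N.
Hypothesis b_pos : forall i, (i < D)%N -> (0 < b_ e i)%N.
Hypothesis b_last : b_ e D = 0%N.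
Hypothesis c_one : c_ e 1 = 1%N.

Lemma c_posR i : (0 < i <= D)%N -> 0 < c i. Proof. by rewrite ltr0n; apply: c_pos. Qed.
Lemma b_posR i : (i < D)%N -> 0 < b i. Proof. by rewrite ltr0n; apply: b_pos. Qed.
Lemma bc_sumR i : (i <= D)%N -> b i + c i = k.
Proof. by move=> le_i; rewrite -natrD bc_sum. Qed.

Lemma f_SS i : f i.+2 = (c i.+2)^-1 *: ('X * f i.+1 - b i *: f i).
Proof. by []. Qed.

Lemma f_rec0 t : (0 < D)%N -> t = c 1 * (f 1).[t].
Proof.
move=> lt_i; have c0 : c 1 != 0 by rewrite lt0r_neq0 // c_posR.
by rewrite /= subr0 mulr1 hornerZ hornerX mulVKf.
Qed.

Lemma f_rec i t : (i.+1 < D)%N ->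
  t * (f i.+1).[t] = b i * (f i).[t] + c i.+2 * (f i.+2).[t].
Proof.
move=> lt_i; have c0 : c i.+2 != 0 by rewrite lt0r_neq0 // c_posR.
have := f_SS i; move: (f i.+2) (f i.+1) (f i) => f2 f1 f0 ->.
by rewrite !(hornerZ, hornerD, hornerN, hornerM, hornerX) mulVKf // [RHS]addrC subrK.
Qed.

Lemma p0E : p 0 = 1. Proof. by rewrite /p_ big_mkcond /= big_ord1. Qed.

Lemma p1E : p 1 = f 1.
Proof. by rewrite /p_ big_mkcond /= big_ord_recr /= big_ord1 add0r. Qed.

Lemma p_SS i : p i.+2 = p i + f i.+2.
Proof.
rewrite /p_ big_mkcond big_ord_recr big_ord_recr -!big_mkcond /=.
rewrite !negbK eqxx; case: (odd i); rewrite /= addr0 //;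
by congr (_ + _); apply: eq_bigl => j; case: odd.
Qed.

(** Adding up the recurrences of the [f_j] gives each inner [f_j] the coefficient
    [b_j + c_j = k]; replacing [k] by [b_{i+2} + c_{i+2}] turns the last term
    into a multiple of [p_{i+2}]. *)
Lemma p_rec i t : (i.+1 < D)%N ->
  t * (p i.+1).[t] = b i.+2 * (p i).[t] + c i.+2 * (p i.+2).[t].
Proof.
have [m] := ubnP i; elim: m i => // m IH [|[|i]] lt_m ltD.
- have kE := bc_sumR ltD; have := f_rec t ltD; rewrite p_SS p1E !hornerD p0E => ->.
  by rewrite hornerC -[b 0]/k -kE; ring.
- have ltD1 := ltnW ltD; have ltD0 := ltnW ltD1.
  have kE := bc_sumR ltD; have k1 := bc_sumR ltD0.
  have f0 := f_rec0 t ltD0; have f1 := f_rec t ltD; rewrite !p_SS p0E !p1E.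
  rewrite !hornerD mulrDr f1 hornerC mulr1 [X in X + _]f0.
  have -> : b 1 = k - c 1 by rewrite -k1 addrK.
  by rewrite -kE; ring.
- have ltD1 := ltnW ltD; have ltD2 := ltnW ltD1.
  have lt_i : (i < m)%N by rewrite -ltnS ltnW.
  have IHi := IH i lt_i ltD2.
  have kE := bc_sumR ltD; have k1 := bc_sumR ltD2.
  have := f_rec t ltD; rewrite (p_SS i.+1) hornerD mulrDr IHi (p_SS i.+2) => ->.
  have -> : (f i.+2).[t] = (p i.+2).[t] - (p i).[t].
    by rewrite p_SS hornerD addrC addKr.
  rewrite hornerD.
  have -> : c i.+2 = k - b i.+2 by rewrite -k1 addrC addKr.
  by rewrite -kE; ring.
Qed.

Lemma size_p_le i : (size (p i) <= i.+1)%N.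
Proof.
have size_f j : (size (f j) <= j.+1)%N.
  have [m] := ubnP j; elim: m j => // m IH [|[|j]] lt_m.
  - by rewrite size_poly1.
  - by rewrite (leq_trans (size_scale_leq _ _)) // mulr1 subr0 size_polyX.
  rewrite f_SS (leq_trans (size_scale_leq _ _)) //.
  rewrite (leq_trans (size_polyD _ _)) // geq_max size_polyN; apply/andP; split.
    rewrite (leq_trans (size_polyMleq _ _)) // size_polyX.
    by rewrite !addSn ltnS (IH j.+1).
  rewrite (leq_trans (size_scale_leq _ _)) //.
  by rewrite (leq_trans (IH j (ltnW lt_m))) // leqW.
apply: leq_trans (size_sum _ _ _) _; apply/bigmax_leqP => j _.
by rewrite (leq_trans (size_f _)).
Qed.

Lemma p_opp i t : (p i).[- t] = (-1) ^+ i * (p i).[t].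
Proof.
have f_opp j : (f j).[- t] = (-1) ^+ j * (f j).[t].
  have [m] := ubnP j; elim: m j => // m IH [|j] lt_m.
    by rewrite !hornerC mul1r.
  case: j lt_m => [|j] lt_m.
    by rewrite /= mulr1 subr0 !hornerZ !hornerX mulrN expr1 mulN1r.
  have := IH j (ltnW lt_m); have := IH j.+1 lt_m; have := f_SS j.
  move: (f j.+2) (f j.+1) (f j) => f2 f1 f0 -> IH1 IH0.
  rewrite !(hornerZ, hornerD, hornerN, hornerM, hornerX) IH1 IH0 !exprS.
  by move: (c j.+2)^-1 => cV; ring.
rewrite /p_ !horner_sum mulr_sumr; apply: eq_bigr => j /eqP par.
by rewrite f_opp -signr_odd par signr_odd.
Qed.

(** From [k] on the values increase with the index: [c_{i+2} p_{i+2}] is at least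
    [k p_{i+1} - b_{i+2} p_i], and [k - b_{i+2} = c_{i+2}]. *)
Lemma p_ge1 i t : (i <= D)%N -> 1 <= k -> k <= t -> 1 <= (p i).[t].
Proof.
move=> le_i k1 kt; have t1 := le_trans k1 kt.
suff [] : 1 <= (p i).[t] /\ ((i < D)%N -> (p i).[t] <= (p i.+1).[t]) by [].
elim: i le_i => [|i IH] le_i.
  rewrite p0E p1E hornerC lexx; split=> // D0.
  by rewrite (_ : (f 1).[t] = t) // [RHS]f_rec0 // c_one mul1r.
have [p1 /(_ le_i) mon] := IH (ltnW le_i).
have p1' := le_trans p1 mon; split=> // ltD.
have := p_rec t ltD; have := bc_sumR ltD => kE rec.
have cp := @c_posR i.+2 ltD.
rewrite -(ler_pM2l cp).
have b0 : 0 <= b i.+2 by rewrite ler0n.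
have h1 : b i.+2 * (p i).[t] <= b i.+2 * (p i.+1).[t] by rewrite ler_wpM2l.
have h2 : k * (p i.+1).[t] <= t * (p i.+1).[t].
  by rewrite ler_wpM2r // (le_trans ler01).
by rewrite -kE mulrDl in h2; lra.
Qed.

(** * The scalars of the module *)

(** For [t] the eigenvalue that gives the local eigenvalue, the outer component
    [E_{i+2} A_{i+4} v] is [- outer_coef t i] times [w_i]. *)
Definition outer_coef t i : R :=
  - (b i.+2 * b i.+3 / (c i.+1 * c i.+2) * ((p i).[t] / (p i.+2).[t])).

Lemma c_neq0 i : (i < D)%N -> c i.+1 != 0.
Proof. by move=> lt_i; rewrite lt0r_neq0 // c_posR. Qed.

Lemma theta_tilde_outer_coef t : (2 < D)%N -> (p 2).[t] != 0 -> theta_tilde e t = outer_coef t 0 - 1.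
Proof.
move=> D2 p2; have c2 := c_neq0 (ltnW D2).
have p2E : c 2 * (p 2).[t] = t ^+ 2 - b 2.
  have := p_rec t (ltnW D2); rewrite p0E hornerC mulr1 p1E.
  have <- : t = (f 1).[t] by rewrite [LHS](f_rec0 t) ?c_one ?mul1r // ltnW // ltnW.
  by rewrite expr2 => ->; rewrite addrC addKr.
rewrite /theta_tilde /outer_coef -p2E p0E hornerC c_one.
by field; rewrite c2 p2.
Qed.

(** The case of [omega_outer_coef] below the range of its indices, where the
    term in [c_0] disappears. *)
Lemma omega1_outer_coef t : (2 < D)%N -> (p 1).[t] != 0 -> (p 2).[t] != 0 ->
  omega e t 1 = b 0 + c 2 * (outer_coef t 0 - 1).
Proof.
move=> D2 p1 p2; have c2 := c_neq0 (ltnW D2).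
have rec1 := p_rec t (ltnW D2).
have rec2 := p_rec t D2.
have kE := bc_sumR (ltnW D2).
have p1t : t = (p 1).[t].
  by rewrite p1E [LHS](f_rec0 t) ?c_one ?mul1r // ltnW // ltnW.
rewrite /omega /outer_coef c_one -[b 0]/k -kE p0E hornerC /=.
move: rec1 rec2; rewrite p0E hornerC -p1t.
have t0 : t != 0 by rewrite p1t.
move: (p 2).[t] (p 3).[t] p2 => p2 p3 p2_neq0 rec1 rec2.
have -> : b 2 * c 3 / 1 * (1 * p3 / (t * p2)) = b 2 * (c 3 * p3) / (t * p2).
  by field; rewrite t0 p2_neq0.
have -> : c 3 * p3 = t * p2 - b 3 * t by rewrite rec2 addrC addKr.
by field; rewrite t0 c2 p2_neq0.
Qed.

(** Once [b_{i+1}] is expressed through [b_{i+3}] by [b + c = k], the recurrence at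
    [i] and at [i + 2] eliminates [p_i] and [p_{i+4}]; what remains is an
    identity of rational functions. *)
Lemma omega_outer_coef t i : (i.+3 < D)%N ->
  (p i.+1).[t] != 0 -> (p i.+2).[t] != 0 -> (p i.+3).[t] != 0 ->
  omega e t i.+2 = b i.+1 + c i.+3 * (outer_coef t i.+1 - 1) - c i.+1 * (outer_coef t i - 1).
Proof.
move=> lt_i p1 p2 p3.
have lt3 := ltnW lt_i; have lt2 := ltnW lt3; have lt1 := ltnW lt2.
have c1' := c_neq0 lt1; have c2' := c_neq0 lt2; have c3' := c_neq0 lt3.
have rec1 := p_rec t lt2.
have rec3 := p_rec t lt_i.
have := bc_sumR lt3; rewrite -(bc_sumR lt1) => kE.
rewrite /omega /outer_coef /=.
move: (p i).[t] (p i.+1).[t] (p i.+2).[t] (p i.+3).[t] (p i.+4).[t]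
  p1 p2 p3 rec1 rec3 => p0 p1 p2 p3 p4 h1 h2 h3 rec1 rec3.
have -> : b i.+3 * c i.+4 / c i.+2 * (p1 * p4 / (p2 * p3))
  = b i.+3 / c i.+2 * (p1 / (p2 * p3)) * (c i.+4 * p4).
  by field; rewrite h2 h3 c2'.
have -> : c i.+4 * p4 = t * p3 - b i.+4 * p2 by rewrite rec3 addrC addKr.
have -> : b i.+2 * b i.+3 / (c i.+1 * c i.+2) * (p0 / p2)
  = b i.+3 / (c i.+1 * c i.+2) / p2 * (b i.+2 * p0).
  by field; rewrite h2 c2' c1'.
have -> : b i.+2 * p0 = t * p1 - c i.+2 * p2 by rewrite rec1 addrK.
have -> : b i.+1 = b i.+3 + c i.+3 - c i.+1 by rewrite kE addrK.
by field; rewrite h2 h3 c1' c2' c3'.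
Qed.

Lemma outer_coef_omega t i : (i.+3 < D)%N -> (p i.+1).[t] != 0 ->
  (p i.+2).[t] != 0 -> (p i.+3).[t] != 0 ->
  outer_coef t i.+1 * omega e t i.+1 = b i.+4 * outer_coef t i.
Proof.
move=> lt_i p1 p2 p3.
have lt3 := ltnW lt_i; have lt2 := ltnW lt3; have lt1 := ltnW lt2.
have c1' := c_neq0 lt1; have c2' := c_neq0 lt2; have c3' := c_neq0 lt3.
rewrite /omega /outer_coef /=; field.
by rewrite p1 p2 p3 c1' c2' c3'.
Qed.

Lemma omega_neq0 t i : (i.+2 < D)%N -> (p i).[t] != 0 -> (p i.+1).[t] != 0 ->
  (p i.+2).[t] != 0 -> (p i.+3).[t] != 0 -> omega e t i.+1 != 0.
Proof.
move=> lt_i p0 p1 p2 p3; rewrite /omega /= !mulf_neq0 ?invr_eq0 ?mulf_neq0 ?c_neq0 //.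
  by rewrite lt0r_neq0 // b_posR.
by rewrite ltnW // ltnW.
Qed.

(** * Roots and signs of the polynomials p *)

Hypothesis D_ge2 : (1 < D)%N.

Lemma p_last t : t * (p D.-1).[t] = k * (p D).[t].
Proof.
have D2 : D.-2.+2 = D by move: D_ge2; case: (D) => [|[]].
have -> : D.-1 = D.-2.+1 by rewrite -{1}D2.
have lt : (D.-2.+1 < D)%N by rewrite D2.
have := p_rec t lt; have := bc_sumR (leqnn D).
by rewrite D2 b_last mul0r !add0r => ->.
Qed.

Hypothesis k_ge1 : 1 <= k.

Lemma p_at0 j : (j.*2 < D)%N -> 0 < (-1) ^+ j * (p j.*2).[0].
Proof.
elim: j => [|j IH] lt_j; first by rewrite p0E hornerC mulr1.
have lt1 : (j.*2.+1 < D)%N by rewrite ltnW.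
have := p_rec 0 lt1; rewrite mul0r => rec.
have bp := b_posR lt_j; have cp := @c_posR j.*2.+2 (ltnW lt_j).
have {IH} := IH (ltnW lt1); rewrite doubleS exprS -(pmulr_rgt0 _ bp) => h.
rewrite -(pmulr_rgt0 _ cp).
have eqc : c j.*2.+2 * (p j.*2.+2).[0] = - (b j.*2.+2 * (p j.*2).[0]).
  by apply/eqP; rewrite -addr_eq0 addrC -rec.
have -> // : c j.*2.+2 * (-1 * (-1) ^+ j * (p j.*2.+2).[0])
        = b j.*2.+2 * ((-1) ^+ j * (p j.*2).[0]).
by rewrite mulrCA eqc; ring.
Qed.

Variable theta : nat -> R.
Hypothesis theta_decr : forall i j, (i < j)%N -> (j <= D)%N -> theta j < theta i.
Hypothesis theta_root : forall i, (i <= D)%N -> theta i != k ->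
  (p D).[theta i] + (p D.-1).[theta i] = 0.

Let q := p D.-1.

(** Beyond [k] both [p_D] and [p_{D-1}] are positive; before [- k], parity and
    [p_last] reduce [p_D + p_{D-1} = 0] to [k = - theta i]. *)
Lemma theta_le_k i : (i <= D)%N -> theta i <= k.
Proof.
move=> le_i; rewrite leNgt; apply/negP => lt.
have := theta_root le_i; rewrite gt_eqF // => /(_ isT) s0.
have h1 := p_ge1 (leqnn D) k_ge1 (ltW lt).
have h2 := p_ge1 (leq_pred D) k_ge1 (ltW lt).
lra.
Qed.

Lemma theta_ge_Nk i : (i <= D)%N -> - k <= theta i.
Proof.
move=> le_i; rewrite leNgt; apply/negP => lt.
have k0 : 0 < k := lt_le_trans ltr01 k_ge1.
have := theta_root le_i; rewrite lt_eqF; last first.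
  by rewrite (lt_trans lt) // gtrN.
move=> /(_ isT); have [s sE] : exists s, theta i = - s.
  by exists (- theta i); rewrite opprK.
have lt_ks : k < s by move: lt; rewrite sE ltrN2.
rewrite sE !p_opp -[in (-1) ^+ D](prednK (ltnW D_ge2)) exprS.
rewrite mulN1r mulNr addrC => /eqP.
rewrite -mulrBr mulf_eq0 signr_eq0 /= subr_eq0 => /eqP eq_s.
have := p_last s; rewrite -eq_s => /eqP.
have h2 := p_ge1 (leq_pred D) k_ge1 (ltW lt_ks).
by rewrite -subr_eq0 -mulrBl mulf_eq0 subr_eq0 !gt_eqF // (lt_le_trans ltr01).
Qed.

(** Substituting [p_D = - p_{D-1}] in [t p_{D-1} = k p_D] leaves
    [(t + k) p_{D-1} = 0]. *)
Lemma theta_root_pred i : (0 < i < D)%N -> q.[theta i] = 0.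
Proof.
case/andP=> i0 lt_iD.
have ltk : theta i < k.
  by apply: lt_le_trans (theta_decr i0 (ltnW lt_iD)) (theta_le_k _).
have gtk : - k < theta i.
  by apply: le_lt_trans (theta_ge_Nk _) (theta_decr lt_iD (leqnn D)).
have := theta_root (ltnW lt_iD); rewrite lt_eqF // => /(_ isT) sum0.
have := p_last (theta i); rewrite -/q.
have -> : (p D).[theta i] = - q.[theta i] by apply/eqP; rewrite -addr_eq0 sum0.
rewrite mulrN => /eqP; rewrite -addr_eq0 -mulrDl mulf_eq0 => /orP[/eqP h|/eqP //].
by move: gtk; rewrite -subr_gt0 opprK h ltxx.
Qed.

Lemma p_pred_neq0 : q != 0.
Proof.
apply/eqP => q0; have := p_ge1 (leq_pred D) k_ge1 (lexx k).
by rewrite -/q q0 horner0 ler10.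
Qed.

Lemma theta_inj i j : (i <= D)%N -> (j <= D)%N -> theta i = theta j -> i = j.
Proof.
move=> le_i le_j; case: (ltngtP i j) => // lt eq.
  by have := theta_decr lt le_j; rewrite eq ltxx.
by have := theta_decr lt le_i; rewrite eq ltxx.
Qed.

(** The [D - 1] distinct roots [theta_1, ..., theta_{D-1}] exhaust the degree. *)
Lemma root_predP t : root q t -> exists2 i, (0 < i < D)%N & t = theta i.
Proof.
move=> qt; pose s := [seq theta i | i <- iota 1 D.-1].
have in_iota i : i \in iota 1 D.-1 = (0 < i < D)%N.
  by rewrite mem_iota add1n prednK // ltnW.
have us : uniq s.
  rewrite map_inj_in_uniq ?iota_uniq // => i j.
  by rewrite !in_iota => /andP[_ /ltnW le_i] /andP[_ /ltnW le_j]; apply: theta_inj.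
have [ts|ts] := boolP (t \in s).
  by have /mapP[j] := ts; rewrite in_iota; exists j.
have : (size (t :: s) < size q)%N.
  apply: max_poly_roots p_pred_neq0 _ _; rewrite /= ?ts // qt /=.
  apply/allP => _ /mapP[j + ->]; rewrite in_iota => lt_i.
  by rewrite /root theta_root_pred.
rewrite /= size_map size_iota ltnNge.
by rewrite (leq_trans (size_p_le _)) // prednK // ltnW.
Qed.

(** The roots of [q] are stable under negation, which reverses their order; a
    decreasing enumeration is unique. *)
Lemma theta_opp i : (0 < i < D)%N -> theta (D - i) = - theta i.
Proof.
pose s := [seq theta i | i <- iota 1 D.-1].
pose s' := [seq - theta i | i <- rev (iota 1 D.-1)].
have in_iota j : j \in iota 1 D.-1 = (0 < j < D)%N.
  by rewrite mem_iota add1n prednK // ltnW.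
have decr : {in iota 1 D.-1 &, forall i j, (i < j)%N -> theta j < theta i}.
  move=> j l; rewrite !in_iota => _ /andP[_ lt_l] lt_jl.
  by apply: theta_decr => //; apply: ltnW.
have s_sorted : sorted (fun x y => y < x) s.
  rewrite sorted_map; apply: (sub_in_sorted (P := mem (iota 1 D.-1))) (iota_ltn_sorted _ _).
    exact: decr.
  exact/allP.
have s'_sorted : sorted (fun x y => y < x) s'.
  rewrite sorted_map rev_sorted.
  apply: (sub_in_sorted (P := mem (iota 1 D.-1))) (iota_ltn_sorted _ _).
    by move=> j l hj hl /= lt_jl; rewrite ltrN2; apply: decr.
  exact/allP.
have mem_s x : x \in s = root q x.
  apply/mapP/idP => [[j] | /root_predP[j]]; last by rewrite -in_iota; exists j.
  by rewrite in_iota => lt_j ->; rewrite /root theta_root_pred.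
have mem_s' x : x \in s' = root q x.
  have -> : root q x = root q (- x) by rewrite /root /q p_opp mulf_eq0 signr_eq0.
  rewrite -mem_s; apply/mapP/mapP => -[j]; rewrite ?mem_rev => hj.
    by move->; exists j; rewrite // opprK.
  by move=> xE; exists j; rewrite ?mem_rev // -xE opprK.
have eq_ss : s = s'.
  have tr : transitive (fun x y : R => y < x).
    by move=> y x z lt_yx lt_zy; apply: lt_trans lt_yx.
  have ir : irreflexive (fun x y : R => y < x) by move=> x; rewrite ltxx.
  by apply: (irr_sorted_eq tr ir) => // x; rewrite mem_s mem_s'.
case/andP=> i0 lt_i; have lt_i1 : (i.-1 < D.-1)%N by rewrite -ltnS !prednK // ltnW.
have := congr1 (fun r => nth 0 r i.-1) eq_ss; rewrite /s /s'.
rewrite (nth_map 0) ?size_iota // (nth_map 0) ?size_rev ?size_iota //.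
rewrite nth_rev ?size_iota // !nth_iota //; last first.
  by rewrite prednK // ltn_subrL i0 /= -ltnS prednK // ltnW.
rewrite !add1n prednK // => ->; rewrite opprK; congr theta.
lia.
Qed.

(** All [p_j] are positive at [k].  Moving down from [k] to [theta_1], suppose they
    are all still nonnegative.  The recurrence at a zero of [p_{j+1}] is then
    [b p_j + c p_{j+2} = 0] with nonnegative terms, so that [p_j] vanishes too,
    and so on down to [p_0 = 1]. *)
Lemma p_theta1_neq0 i : (i < D.-1)%N -> (p i).[theta 1] != 0.
Proof.
move=> lt_i.
have lt_k : theta 1 < k.
  by apply: lt_le_trans (theta_decr _ _) (theta_le_k (leq0n D)); rewrite // ltnW.
(* [sign_barrier] moves to the right, hence the reflection. *)
have le : - k <= - theta 1 by rewrite lerN2 ltW.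
suff : 0 < (p i \Po - 'X).[- theta 1] by rewrite horner_comp !hornerE opprK => /lt0r_neq0.
apply: (sign_barrier (m := D.-1) (g := fun j => p j \Po - 'X) le _ _ lt_i) => [j lt_j|t].
  rewrite horner_comp !hornerE opprK (lt_le_trans ltr01) // p_ge1 //.
  by rewrite (leq_trans (ltnW lt_j)) // leq_pred.
case/andP=> lt_kt le_t ge0.
have {}ge0 j : (j < D)%N -> 0 <= (p j).[- t].
  move=> lt_j; have : (j <= D.-1)%N by lia.
  rewrite leq_eqVlt => /predU1P[->|]; last first.
    by move/ge0; rewrite horner_comp !hornerE.
  have -> : (p D.-1).[- t] = (q \Po - 'X).[t] by rewrite horner_comp !hornerE.
  apply: (@poly_ge0_no_root _ _ (- k) (- theta 1)).
  - by rewrite horner_comp !hornerE opprK (lt_le_trans ltr01) // p_ge1 // leq_pred.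
  - move=> u /andP[lt_ku lt_u]; rewrite /root horner_comp !hornerE.
    apply/negP => /root_predP[j' /andP[j0 lt_j'] uE].
    move: lt_u; rewrite ltrNr uE ltNge; case/negP.
    by move: j0; rewrite leq_eqVlt => /predU1P[<- //|lt1]; rewrite ltW // theta_decr // ltnW.
  - by rewrite ltW.
move=> j lt_j; rewrite horner_comp !hornerE; apply/eqP.
elim: j lt_j => [|j IH] lt_j; first by rewrite p0E hornerC => /eqP; rewrite oner_eq0.
have lt2 : (j.+2 < D)%N by rewrite -ltn_predRL.
move=> pj; apply: IH; first exact: ltnW.
have lt0 : (j < D)%N by rewrite ltnW // ltnW.
have := p_rec (- t) (ltnW lt2); rewrite pj mulr0 => /esym/eqP.
rewrite paddr_eq0 ?mulr_ge0 ?ge0 ?ler0n //.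
by case/andP; rewrite mulf_eq0 gt_eqF ?b_posR //= => /eqP.
Qed.

(** Near 0 the signs of the [p_i] follow the pattern [+ + - -]; those of odd index
    follow from those of even index, as the recurrence writes the signed
    [p_{2m+1}] as a sum with nonnegative coefficients. *)
Lemma p_odd_gt0 t m : 0 < t -> (m.*2.+1 < D)%N ->
  (forall j, (j <= m)%N -> 0 <= (-1) ^+ j * (p j.*2).[t]) ->
  0 < (-1) ^+ m * (p m.*2.+1).[t].
Proof.
move=> t0; elim: m => [|m IH] lt_m ge0.
  have := f_rec0 t (ltnW lt_m); rewrite c_one mul1r p1E => <-.
  by rewrite mul1r.
have lt3 : (m.*2.+3 < D)%N by move: lt_m; rewrite doubleS.
have {}IH : 0 < (-1) ^+ m * (p m.*2.+1).[t].
  by apply: IH => [|j le_j]; [rewrite ltnW // ltnW | rewrite ge0 // ltnW].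
have := p_rec t (ltnW lt3); have := ge0 m.+1 (leqnn _); rewrite doubleS exprS.
have cp := @c_posR m.*2.+3 (ltnW lt3); have bp := b_posR lt3.
move: ((-1) ^+ m) (p _).[t] (p _).[t] (p _).[t] IH => s p3 p2 p1 p1_gt0 ge rec.
rewrite -(pmulr_rgt0 _ cp).
have -> : c m.*2.+3 * (-1 * s * p3) = t * (-1 * s * p2) + b m.*2.+3 * (s * p1).
  have -> : c m.*2.+3 * (-1 * s * p3) = - s * (c m.*2.+3 * p3) by ring.
  have -> : c m.*2.+3 * p3 = t * p2 - b m.*2.+3 * p1 by rewrite rec addrC addKr.
  by ring.
by apply: ltr_wpDl; [apply: mulr_ge0 => //; apply: ltW | apply: mulr_gt0].
Qed.

(** With [D = 2 d + 1], symmetry makes [theta_d] the smallest positive root of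
    [p_{D-1}].  Moving up from 0, a zero of [p_{2j}] with the sign pattern intact
    would give [p_{2j+2}] the sign opposite to its own in the pattern, by the
    recurrence and the strict sign of [p_{2j+1}]. *)
Lemma p_theta_half_neq0 l : odd D -> (l < D.-1)%N -> (p l).[theta D./2] != 0.
Proof.
move=> oddD; have DE : D = (D./2).*2.+1 by rewrite -[LHS]odd_double_half oddD.
move: (D./2) DE => d DE; set t0 := theta d.
have d0 : (0 < d)%N by move: D_ge2; rewrite DE; case: (d).
have lt_d : (0 < d < D)%N by rewrite d0 DE ltnS -addnn leq_addr.
have opp_t0 : theta d.+1 = - t0.
  have -> : d.+1 = (D - d)%N by lia.
  exact: theta_opp.
have t0_gt0 : 0 < t0.
  have : theta d.+1 < t0 by apply: theta_decr => //; lia.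
  by rewrite opp_t0 => ?; lra.
have D1 : D.-1 = d.*2 by rewrite DE.
pose g j := (-1) ^+ j *: p j.*2.
have g_t j t : (g j).[t] = (-1) ^+ j * (p j.*2).[t] by rewrite hornerZ.
have g_at0 j : (j <= d)%N -> 0 < (g j).[0].
  by move=> le_j; rewrite g_t p_at0 // DE ltnS leq_double.
have g_last t : 0 <= t <= t0 -> 0 <= (g d).[t].
  apply: poly_ge0_no_root; first exact: g_at0.
  move=> u /andP[u0 lt_u]; rewrite /root g_t mulf_eq0 signr_eq0 /= -D1.
  apply/negP => /root_predP[j /andP[j0 lt_j] uE].
  have [le_jd|lt_dj] := leqP j d.
    move: lt_u; rewrite uE ltNge => /negP; apply.
    move: le_jd; rewrite leq_eqVlt => /predU1P[-> //|lt].
    by rewrite ltW // theta_decr // ltnW; case/andP: lt_d.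
  have : u <= - t0.
    rewrite uE -opp_t0; move: lt_dj; rewrite leq_eqVlt => /predU1P[-> //|lt].
    by rewrite ltW // theta_decr // ltnW.
  by rewrite leNgt (lt_trans _ u0) // oppr_lt0.
have g_pos : forall j, (j < d)%N -> 0 < (g j).[t0].
  apply: (sign_barrier (a := 0)) (ltW t0_gt0) _ _ => [j /ltnW|t]; first exact: g_at0.
  case/andP=> t_gt0 le_t ge0 j lt_j; apply/negP; rewrite g_t mulf_eq0 signr_eq0 /=.
  move/eqP => pj.
  have ge0' r : (r <= d)%N -> 0 <= (g r).[t].
    by rewrite leq_eqVlt => /predU1P[->|/ge0 //]; rewrite g_last // ltW.
  have lt1 : (j.*2.+1 < D)%N by rewrite DE ltnS ltn_double.
  have odd_gt0 : 0 < (-1) ^+ j * (p j.*2.+1).[t].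
    by apply: p_odd_gt0 => // r le_r; rewrite -g_t ge0' // (leq_trans le_r) // ltnW.
  have := p_rec t lt1; rewrite pj mulr0 add0r => rec.
  have := ge0' j.+1 lt_j; rewrite g_t doubleS exprS.
  have cp := @c_posR j.*2.+2 lt1; rewrite -(pmulr_rge0 _ cp).
  have -> : c j.*2.+2 * (-1 * (-1) ^+ j * (p j.*2.+2).[t])
      = - (t * ((-1) ^+ j * (p j.*2.+1).[t])).
    by rewrite [t * _]mulrCA rec; ring.
  by rewrite leNgt oppr_lt0 mulr_gt0.
rewrite D1 => lt_l; rewrite -[l]odd_double_half.
have lt_half : (l./2 < d)%N by rewrite ltn_half_double.
case: (odd l); rewrite ?add0n ?add1n; last first.
  by have := lt0r_neq0 (g_pos _ lt_half); rewrite g_t mulf_eq0 negb_or => /andP[].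
have /lt0r_neq0 : 0 < (-1) ^+ l./2 * (p l./2.*2.+1).[t0].
  apply: p_odd_gt0 => // [|j le_j]; first by rewrite DE ltnS ltn_double.
  by rewrite -g_t ltW // g_pos // (leq_ltn_trans le_j).
by rewrite mulf_eq0 negb_or => /andP[].
Qed.

End Recurrence.

(** * Distances *)

Section Graph.

Variables (R : realType) (X : finType) (e : rel X).
Hypotheses (e_sym : symmetric e) (e_irr : irreflexive e) (e_conn : connected e).
Variable x : X.
Local Open Scope nat_scope.

Lemma walkP n y z :
  reflect (exists s, [/\ size s = n, path e y s & last y s = z])
    (walk e n y z).
Proof.
apply: (iffP existsP) => [[s /andP[ps /eqP lst]]|[s [sz ps lst]]].
  by exists s; rewrite size_tuple.
by exists (tcast sz (in_tuple s)); rewrite val_tcast /= ps lst eqxx.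
Qed.

Lemma walk0 y z : walk e 0 y z = (y == z).
Proof.
apply/walkP/eqP => [[s [/size0nil-> _ <-]] //|->].
by exists [::].
Qed.

Lemma walkS n y z : walk e n.+1 y z = [exists u, e y u && walk e n u z].
Proof.
apply/walkP/existsP => [[[|u s] [sz ps lst]]|[u]] //.
  case/andP: ps => yu ps; case: sz => sz.
  by exists u; rewrite yu; apply/walkP; exists s.
case/andP=> yu /walkP[s [sz ps lst]].
by exists (u :: s); rewrite /= sz yu ps.
Qed.

Lemma walk_sym n y z : walk e n y z = walk e n z y.
Proof.
suff sub u w : walk e n u w -> walk e n w u by apply/idP/idP; apply: sub.
case/walkP=> s [sz ps lst]; apply/walkP.
exists (rev (belast u s)); split; first by rewrite size_rev size_belast.
  by rewrite -lst rev_path (eq_path (e' := e)) // => a b; rewrite e_sym.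
case: s lst {sz ps} => [<- //|a s _] /=.
by rewrite rev_cons last_rcons.
Qed.

Lemma dist_walk y z : (dist e y z < #|X|)%N /\ walk e (dist e y z) y z.
Proof.
have hw : has (fun n => walk e n y z) (iota 0 #|X|).
  have /connectP[s ps lst] := e_conn y z.
  case: (shortenP ps) lst => s' ps' us' _ lst.
  apply/hasP; exists (size s'); last by apply/walkP; exists s'.
  rewrite mem_iota /= add0n.
  by have := max_card (mem (y :: s')); rewrite (card_uniqP us').
have lt : (dist e y z < #|X|)%N by move: hw; rewrite has_find size_iota.
by split=> //; have := nth_find 0 hw; rewrite -/(dist e y z) nth_iota // add0n.
Qed.

Lemma dist_le n y z : walk e n y z -> (dist e y z <= n)%N.
Proof.
move=> w; case: (leqP #|X| n) => [|ltn].
  by apply: leq_trans; apply: ltnW; case: (dist_walk y z).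
rewrite leqNgt; apply/negP => /(before_find 0).
by rewrite nth_iota // add0n w.
Qed.

Lemma dist_eq0 y z : (dist e y z == 0%N) = (y == z).
Proof.
apply/eqP/eqP => [d0|->]; last first.
  by apply/eqP; rewrite -leqn0; apply: dist_le; rewrite walk0.
by have [_] := dist_walk y z; rewrite d0 walk0 => /eqP.
Qed.

Lemma distxx y : dist e y y = 0%N. Proof. by apply/eqP; rewrite dist_eq0. Qed.

Lemma dist_sym y z : dist e y z = dist e z y.
Proof. by apply: eq_find => n; rewrite walk_sym. Qed.

Lemma dist_eq1 y z : (dist e y z == 1%N) = e y z.
Proof.
apply/eqP/idP => [d1|yz].
  have [_] := dist_walk y z; rewrite d1 walkS => /existsP[u].
  by rewrite walk0 => /andP[yu /eqP<-].
have le1 : (dist e y z <= 1)%N.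
  by apply: dist_le; rewrite walkS; apply/existsP; exists z; rewrite yz walk0 eqxx.
apply/eqP; rewrite eqn_leq le1 lt0n dist_eq0.
by apply/eqP => yz'; rewrite yz' e_irr in yz.
Qed.

Lemma dist_adj y u z : e y u -> (dist e y z <= (dist e u z).+1)%N.
Proof.
move=> yu; apply: dist_le; rewrite walkS; apply/existsP; exists u.
by rewrite yu; case: (dist_walk u z).
Qed.

Lemma dist_step y z i : dist e y z = i.+1 -> exists2 u, e y u & dist e u z = i.
Proof.
move=> d; have [_] := dist_walk y z; rewrite d walkS => /existsP[u /andP[yu w]].
exists u => //; apply/eqP; rewrite eqn_leq dist_le //=.
by have := dist_adj z yu; rewrite d ltnS.
Qed.

Lemma dist_triangle y z u : (dist e y z <= dist e y u + dist e u z)%N.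
Proof.
move: {2}(dist e y u) (erefl (dist e y u)) => m; elim: m y => [|m IH] y dyu.
  by move/eqP: (dyu); rewrite dist_eq0 => /eqP->; rewrite distxx.
have [w yw dw] := dist_step dyu.
rewrite dyu addSn; apply: leq_trans (dist_adj z yw) _.
by rewrite ltnS -dw; apply: IH.
Qed.

Lemma dist_diam y z : (dist e y z <= diameter e)%N.
Proof.
apply: leq_trans (leq_bigmax (F := dist e y) z) _.
exact: (leq_bigmax (F := fun y => \max_(z : X) dist e y z)%N y).
Qed.

Lemma dist_attained i : (i <= diameter e)%N -> exists y z, dist e y z = i.
Proof.
have [y [z dyz]] : exists y z, dist e y z = diameter e.
  have X0 : (0 < #|X|)%N by apply/card_gt0P; exists x.
  rewrite /diameter; have [y ->] := bigop.eq_bigmax (fun y => \max_(z : X) dist e y z)%N X0.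
  by have [z ->] := bigop.eq_bigmax (dist e y) X0; exists y, z.
have {}dyz : (diameter e <= dist e y z)%N by rewrite dyz.
move/leq_trans/(_ dyz); move: {dyz}y {2}(dist e y z) (erefl (dist e y z)).
move=> y m; elim: m y => [|m IH] y dyz.
  by rewrite dyz leqn0 => /eqP->; exists y, z.
rewrite dyz leq_eqVlt ltnS => /predU1P[->|le_im]; first by exists y, z.
by have [u _ du] := dist_step dyz; apply: (IH u du); rewrite du.
Qed.

Hypothesis e_bip : bipartite e.

(** The parity of a distance tells whether its ends lie in the same part. *)
Lemma dist_parity y z u : odd (dist e y z) = odd (dist e y u) (+) odd (dist e u z).
Proof.
have [U [indU indU']] := e_bip.
have flip a b : e a b -> (b \in U) = ~~ (a \in U).
  move=> ab; case aU: (a \in U); case bU: (b \in U) => //=.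
    by have := indU a b aU bU; rewrite ab.
  by have := indU' a b; rewrite !inE aU bU ab => /(_ isT isT).
suff par a b : odd (dist e a b) = (a \in U) (+) (b \in U).
  by rewrite !par; do 3![case: (_ \in U)].
move: {2}(dist e a b) (erefl (dist e a b)) => m; elim: m a => [|m IH] a d.
  by rewrite d; move/eqP: d; rewrite dist_eq0 => /eqP->; rewrite addbb.
have [w aw dw] := dist_step d.
by rewrite d /= -dw (IH _ dw) (flip a w) //; do 2![case: (_ \in U)].
Qed.

Lemma dist_to_level2 y z : dist e x z = 2 ->
  [|| dist e x y == dist e y z, dist e x y == (dist e y z).+2
    | dist e y z == (dist e x y).+2].
Proof.
move=> xz; have := dist_triangle y z x; have := dist_triangle x y z.
have := dist_triangle x z y; have := dist_parity x y z.
rewrite xz [dist e z y]dist_sym [dist e y x]dist_sym /=; lia.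
Qed.

Lemma dist_adj_cases y u z : e y u ->
  dist e u z = (dist e y z).+1 \/ dist e y z = (dist e u z).+1.
Proof.
move=> yu; have uy : e u y by rewrite e_sym.
have h1 := dist_adj z yu; have h2 := dist_adj z uy.
have h3 := dist_parity y z u; move: yu; rewrite -dist_eq1 => /eqP yu1.
rewrite yu1 /= in h3.
move: h1 h2 h3; rewrite leq_eqVlt ltnS => /predU1P[->|h1]; first by right.
rewrite leq_eqVlt ltnS => /predU1P[->|h2]; first by left.
have -> : dist e y z = dist e u z by apply/eqP; rewrite eqn_leq h1.
by case: odd.
Qed.

(** * Intersection numbers *)

Hypothesis e_dr : distance_regular e.

Lemma inter_numE h i j y z : dist e y z = h ->
  (i <= diameter e)%N -> (j <= diameter e)%N ->
  inter_num e h i j = inter_count e i j y z.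
Proof.
move=> d le_i le_j; rewrite /inter_num; case: pickP => [[a b] /= /eqP dab|none].
  by apply: (e_dr (h := h)) => //; rewrite -d dist_diam.
by have /negP := none (y, z); rewrite /= d eqxx.
Qed.

Hypothesis diam_gt0 : (0 < diameter e)%N.

Lemma card_closer y z i : dist e y z = i.+1 ->
  #|[set u | e y u && (dist e u z == i)]| = c_ e i.+1.
Proof.
move=> d; have le_i : (i.+1 <= diameter e)%N by rewrite -d dist_diam.
rewrite /c_ (inter_numE d) // ?(ltnW le_i) //.
by apply: eq_card => u; rewrite !inE dist_eq1.
Qed.

(** At the diameter both sides are 0. *)
Lemma card_farther y z i : dist e y z = i ->
  #|[set u | e y u && (dist e u z == i.+1)]| = b_ e i.
Proof.
move=> d; have le_i : (i <= diameter e)%N by rewrite -d dist_diam.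
have [lt_i|ge_i] := ltnP i (diameter e).
  rewrite /b_ (inter_numE d) //.
  by apply: eq_card => u; rewrite !inE dist_eq1.
have far u w : (dist e u w == i.+1) = false.
  by apply/negbTE; rewrite neq_ltn ltnS (leq_trans (dist_diam u w) ge_i).
rewrite eq_card0; last by move=> u; rewrite !inE far andbF.
apply/esym; rewrite /b_ /inter_num; case: pickP => // -[a w] _.
by apply: eq_card0 => u; rewrite !inE far andbF.
Qed.

Lemma card_adj y : #|[set u | e y u]| = valency e.
Proof.
rewrite /valency -(card_farther (distxx y)); apply: eq_card => u.
by rewrite !inE dist_sym dist_eq1 andbb.
Qed.

Lemma c_at0 : c_ e 0 = 0%N.
Proof.
rewrite /c_ (inter_numE (distxx x)) //.
apply: eq_card0 => u; rewrite !inE dist_sym; apply/negP => /andP[/eqP->].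
by [].
Qed.

Lemma b_diam : b_ e (diameter e) = 0%N.
Proof.
have [y [z d]] := dist_attained (leqnn (diameter e)).
rewrite -(card_farther d); apply: eq_card0 => u; rewrite !inE.
apply/negP => /andP[_ /eqP d1].
by have := dist_diam u z; rewrite d1 ltnn.
Qed.

Lemma b_add_c i : (i <= diameter e)%N -> (b_ e i + c_ e i = valency e)%N.
Proof.
move=> le_i; have [y [z d]] := dist_attained le_i.
case: i d le_i => [|i] d le_i; first by rewrite c_at0 addn0.
rewrite -(card_closer d) -(card_farther d) -(card_adj y) addnC.
rewrite -cardsUI [X in (_ + X)%N]eq_card0 ?addn0; last first.
  by move=> u; rewrite !inE; apply/negP => /andP[/andP[_ /eqP->]]; rewrite ltn_eqF ?andbF.
apply: eq_card => u; rewrite !inE -andb_orr; apply/andb_idr => yu.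
by have [->|] := dist_adj_cases z yu; rewrite d ?eqxx ?orbT // => -[->]; rewrite eqxx.
Qed.

Lemma c_gt0 i : (0 < i <= diameter e)%N -> (0 < c_ e i)%N.
Proof.
case: i => [|i] //= le_i; have [y [z d]] := dist_attained le_i.
rewrite -(card_closer d); have [u yu du] := dist_step d.
by apply/card_gt0P; exists u; rewrite inE yu du eqxx.
Qed.

Lemma b_gt0 i : (i < diameter e)%N -> (0 < b_ e i)%N.
Proof.
move=> lt_i; have [y [z d]] := dist_attained lt_i.
have [u yu du] := dist_step d.
rewrite -(card_farther du); apply/card_gt0P; exists y.
by rewrite inE e_sym yu d eqxx.
Qed.

Lemma c_at1 : c_ e 1 = 1%N.
Proof.
have [y [z d]] := dist_attained diam_gt0.
rewrite -(card_closer d) -(cards1 z); apply: eq_card => u.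
rewrite !inE dist_eq0; apply/andb_idl => /eqP->.
by rewrite -dist_eq1 d.
Qed.

(** The left-hand side is an entry of the product of the adjacency matrix with a
    distance matrix. *)
Lemma card_adj_dist y z j :
  #|[set u | e y u && (dist e u z == j)]|
  = ((if dist e y z == j.+1 then c_ e j.+1 else 0)
     + (if (dist e y z).+1 == j then b_ e j.-1 else 0))%N.
Proof.
case: eqP => [d|nd].
  by rewrite d gtn_eqF ?ltnS ?leqnSn // addn0 card_closer.
case: eqP => [d|nd'].
  by rewrite -d /= card_farther.
apply: eq_card0 => u; rewrite !inE; apply/negP => /andP[yu /eqP du].
by case: (dist_adj_cases z yu); rewrite du => d; [apply: nd'|apply: nd].
Qed.

(** * Distance matrices and eigenvalues *)

Local Open Scope ring_scope.
Local Open Scope complex_scope.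
Local Notation D := (diameter e).
Local Notation C := R[i].
Local Notation Ad := (dist_mx e R).
Local Notation A := (adj_mx e R).
Local Notation N := #|X|.

Lemma sum_enum_val (F : X -> C) : \sum_(r < N) F (enum_val r) = \sum_y F y.
Proof.
rewrite [RHS](reindex (@enum_val X X)) //=.
by exists enum_rank => [j _|y _]; rewrite ?enum_valK ?enum_rankK.
Qed.

Lemma dist_mx0 : Ad 0 = 1%:M.
Proof.
by apply/matrixP => r s; rewrite !mxE dist_eq0 // (inj_eq enum_val_inj).
Qed.

Lemma dist_mx_tr j : (Ad j)^T = Ad j.
Proof. by apply/matrixP => r s; rewrite !mxE dist_sym. Qed.

Lemma dist_mx_far j : (D < j)%N -> Ad j = 0.
Proof.
move=> lt; apply/matrixP => r s; rewrite !mxE ltn_eqF //.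
exact: leq_ltn_trans (dist_diam _ _) lt.
Qed.

Lemma adj_mxE r s : A r s = (e (enum_val r) (enum_val s))%:R.
Proof. by rewrite mxE dist_eq1. Qed.

Lemma adj_mul_dist_mx j :
  A *m Ad j.+1 = (b_ e j)%:R *: Ad j + (c_ e j.+2)%:R *: Ad j.+2.
Proof.
apply/matrixP => r s; rewrite !mxE.
under eq_bigr => l _ do rewrite adj_mxE mxE -natrM mulnb.
rewrite (sum_enum_val (fun y => (e (enum_val r) y && (dist e y (enum_val s) == j.+1))%:R)).
rewrite -natr_sum -big_mkcond /= sum1_card.
have -> : #|[pred y | e (enum_val r) y && (dist e y (enum_val s) == j.+1)]|
  = #|[set u | e (enum_val r) u && (dist e u (enum_val s) == j.+1)]|.
  by apply: eq_card => y; rewrite !inE.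
rewrite card_adj_dist // natrD addrC eqSS.
by congr (_ + _); case: (_ == _); rewrite ?mulr1 ?mulr0.
Qed.

Lemma sum_dist_mx : \sum_(j < D.+1) Ad j = const_mx 1.
Proof.
apply/matrixP => r s; rewrite summxE mxE.
have lt : (dist e (enum_val r) (enum_val s) < D.+1)%N by rewrite ltnS dist_diam.
rewrite (bigD1 (Ordinal lt)) //= mxE eqxx big1 ?addr0 // => j.
by rewrite -val_eqE /= mxE eq_sym => /negPf->.
Qed.

Lemma ones_mul_adj : const_mx 1 *m A = (valency e)%:R *: const_mx 1 :> 'M[C]_N.
Proof.
apply/matrixP => r s; rewrite !mxE.
under eq_bigr => l _ do rewrite adj_mxE mxE mul1r e_sym.
rewrite (sum_enum_val (fun y => (e (enum_val s) y)%:R)) -natr_sum.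
rewrite -big_mkcond /= sum1_card mulr1 -(card_adj (enum_val s)).
by congr (_%:R); apply: eq_card => y; rewrite !inE.
Qed.

Lemma adj_mul_ones : A *m const_mx 1 = (valency e)%:R *: const_mx 1 :> 'M[C]_N.
Proof.
apply: trmx_inj; rewrite trmx_mul trmx_const dist_mx_tr ones_mul_adj.
by rewrite linearZ /= trmx_const.
Qed.

(** That is, [A_j = f_j(A)]. *)
Lemma eigenvector_dist_mx (u : 'rV[C]_N) (t : R) j : (j <= D)%N ->
  u *m A = t%:C *: u -> u *m Ad j = ((f_ e R j).[t])%:C *: u.
Proof.
move=> + uA; have [m] := ubnP j; elim: m j => // m IH [|[|j]] lt_m le_j.
- by rewrite dist_mx0 mulmx1 hornerC scale1r.
- have := f_rec0 (R := R) (@c_gt0) t le_j; rewrite c_at1 mul1r => <-.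
  exact: uA.
have cn0 : (c_ e j.+2)%:R != 0 :> C.
  by rewrite pnatr_eq0 -lt0n c_gt0.
have := f_rec (R := R) (@c_gt0) t le_j; have := congr1 (mulmx u) (adj_mul_dist_mx j).
rewrite mulmxA uA -scalemxAl mulmxDr -!scalemxAr.
rewrite (IH j.+1 lt_m (ltnW le_j)) (IH j (ltnW lt_m) (ltnW (ltnW le_j))).
move=> rec /(congr1 (fun z => z%:C)).
rewrite rmorphM rmorphD !rmorphM !rmorph_nat => rec'.
move: rec; rewrite !scalerA rec' scalerDl => /addrI eq_c.
by apply: (scalerI cn0); rewrite scalerA eq_c.
Qed.

Lemma p_add_pred i : p_ e R i.+1 + p_ e R i = \sum_(j < i.+2) f_ e R j.
Proof.
elim: i => [|i IH]; first by rewrite big_ord_recr big_ord1 p1E p0E addrC.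
by rewrite big_ord_recr -IH p_SS addrAC [p_ e R i + _]addrC.
Qed.

(** The left-hand side is the eigenvalue on [u] of the sum [J] of all distance
    matrices, and [u J = 0] because [t u J = u A J = k u J]. *)
Lemma eigenvalue_p_root (t : R) : eigenvalue A t%:C -> t != (valency e)%:R ->
  (p_ e R D).[t] + (p_ e R D.-1).[t] = 0.
Proof.
case/eigenvalueP => u uA u0 tk.
have uJ : u *m const_mx 1 = 0 :> 'rV[C]_N.
  have := congr1 (mulmx u) adj_mul_ones.
  rewrite mulmxA uA -scalemxAl -scalemxAr => /eqP.
  rewrite -subr_eq0 -scalerBl scaler_eq0 => /orP[|/eqP //].
  by rewrite -(rmorph_nat (real_complex R)) -rmorphB fmorph_eq0 subr_eq0 (negPf tk).
have : ((p_ e R D).[t] + (p_ e R D.-1).[t])%:C *: u = 0.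
  rewrite -uJ -sum_dist_mx mulmx_sumr -hornerD.
  have -> : p_ e R D + p_ e R D.-1 = \sum_(j < D.+1) f_ e R j.
    by have := p_add_pred D.-1; rewrite prednK.
  rewrite horner_sum rmorph_sum scaler_suml; apply: eq_bigr => j _.
  by rewrite (@eigenvector_dist_mx u t j) // -ltnS.
by move/eqP; rewrite scaler_eq0 (negPf u0) orbF fmorph_eq0 => /eqP.
Qed.

(** * Levels of the distance from x *)

Local Notation E := (dual_idem e R x).
Local Notation V := 'cV[C]_N.
Local Notation lev r := (dist e x (enum_val r)).

Lemma dual_idem_mulE j (u : V) r s : (E j *m u) r s = (lev r == j)%:R * u r s.
Proof.
rewrite mxE (bigD1 r) //= mxE eqxx /= big1 ?addr0 // => l.
by rewrite mxE eq_sym => /negPf->; rewrite mul0r.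
Qed.

Lemma dual_idem_mul j l (u : V) : E j *m (E l *m u) = if j == l then E l *m u else 0.
Proof.
apply/matrixP => r s; rewrite dual_idem_mulE.
have [<-|jl] := eqVneq j l; first by rewrite dual_idem_mulE mulrA -natrM mulnb andbb.
rewrite dual_idem_mulE [RHS]mxE mulrA -natrM mulnb.
by case: eqP => [->|]; rewrite ?(negPf jl) mul0r.
Qed.

Lemma dual_idem_far j : (D < j)%N -> E j = 0.
Proof.
move=> lt; apply/matrixP => r s; rewrite !mxE ltn_eqF ?andbF //.
exact: leq_ltn_trans (dist_diam _ _) lt.
Qed.

(** Edges join consecutive levels only, by bipartiteness. *)
Lemma dual_idem_adj_split j (u : V) :
  E j.+1 *m (A *m u) = E j.+1 *m (A *m (E j *m u)) + E j.+1 *m (A *m (E j.+2 *m u)).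
Proof.
apply/matrixP => r s; rewrite [RHS]mxE !dual_idem_mulE -mulrDr.
have [lev_r|] := eqVneq; rewrite ?mul0r // !mul1r 3!mxE -big_split /=.
apply: eq_bigr => l _; rewrite -mulrDr !dual_idem_mulE -mulrDl -natrD adj_mxE //.
have [adj|_] := boolP (e _ _); last by rewrite !mul0r.
rewrite !mul1r; have := dist_adj_cases x adj.
rewrite ![dist e _ x]dist_sym // lev_r => -[->|[->]].
  by rewrite eqxx gtn_eqF // mul1r.
by rewrite eqxx ltn_eqF // mul1r.
Qed.

Lemma adj_split j (u : V) : E j.+1 *m u = u ->
  A *m u = E j *m (A *m u) + E j.+2 *m (A *m u).
Proof.
move=> Eu; apply/matrixP => r s; rewrite [RHS]mxE !dual_idem_mulE -mulrDl -natrD.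
rewrite ![(A *m u) r s]mxE mulr_sumr; apply: eq_bigr => l _.
have -> : u l s = (lev l == j.+1)%:R * u l s by rewrite -{1}Eu dual_idem_mulE.
have [lev_l|] := eqVneq; rewrite ?mul0r ?mulr0 // !mul1r adj_mxE //.
have [adj|_] := boolP (e _ _); last by rewrite !mul0r mulr0.
rewrite mul1r; have := dist_adj_cases x adj.
rewrite ![dist e _ x]dist_sym // lev_l => -[[<-]|->].
  by rewrite eqxx ltn_eqF // mul1r.
by rewrite eqxx gtn_eqF // mul1r.
Qed.

Section Level2.

Variable v : V.
Hypothesis Ev : E 2 *m v = v.

Lemma dual_idem_dist_mx_eq0 (i j : nat) :
  ~~ [|| i == j, i == j.+2 | j == i.+2] -> E i *m (Ad j *m v) = 0.
Proof.
move=> far; apply/matrixP => r s; rewrite dual_idem_mulE [RHS]mxE.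
have [lev_r|] := eqVneq; rewrite ?mul0r // mul1r mxE big1 // => l _.
rewrite -Ev dual_idem_mulE mxE; have [d_rl|] := eqVneq; rewrite ?mul0r //.
have [lev_l|] := eqVneq; rewrite ?mul0r ?mulr0 //.
by have := dist_to_level2 (enum_val r) lev_l; rewrite lev_r d_rl (negPf far).
Qed.

Lemma adj_dist_mx_mul j (u : V) : A *m (Ad j.+1 *m u)
  = (b_ e j)%:R *: (Ad j *m u) + (c_ e j.+2)%:R *: (Ad j.+2 *m u).
Proof. by rewrite mulmxA adj_mul_dist_mx // mulmxDl -!scalemxAl. Qed.

(** On the topmost level that [A A_i v] can reach, only the term
    [c_{i+1} A_{i+1} v] is present. *)
Lemma raise_w i : E i.+3 *m (A *m w_ e x v i) = (c_ e i.+1)%:R *: w_ e x v i.+1.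
Proof.
have -> : E i.+3 *m (A *m w_ e x v i) = E i.+3 *m (A *m (Ad i *m v)).
  rewrite [RHS]dual_idem_adj_split [X in _ + _ *m (_ *m X)]dual_idem_dist_mx_eq0.
    by rewrite !mulmx0 addr0.
  lia.
case: i => [|i]; first by rewrite dist_mx0 // mul1mx c_at1 // scale1r.
rewrite adj_dist_mx_mul mulmxDr -!scalemxAr dual_idem_dist_mx_eq0.
  by rewrite scaler0 add0r.
lia.
Qed.

Lemma middle_recurrence i :
  E i.+2 *m (A *m w_ e x v i.+1) + E i.+2 *m (A *m (E i.+1 *m (Ad i.+1 *m v)))
  = (b_ e i)%:R *: w_ e x v i + (c_ e i.+2)%:R *: (E i.+2 *m (Ad i.+2 *m v)).
Proof.
by rewrite addrC -dual_idem_adj_split adj_dist_mx_mul mulmxDr -!scalemxAr.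
Qed.

(** Dually to [raise_w], on the lowest level that [A A_{i+5} v] can reach only the
    term in [A_{i+4} v] is present. *)
Lemma outer_recurrence i :
  E i.+2 *m (A *m (E i.+3 *m (Ad i.+4.+1 *m v)))
  = (b_ e i.+4)%:R *: (E i.+2 *m (Ad i.+4 *m v)).
Proof.
have -> : E i.+2 *m (A *m (E i.+3 *m (Ad i.+4.+1 *m v)))
    = E i.+2 *m (A *m (Ad i.+4.+1 *m v)).
  rewrite [RHS]dual_idem_adj_split [X in _ *m (_ *m X) + _]dual_idem_dist_mx_eq0.
    by rewrite !mulmx0 add0r.
  lia.
rewrite adj_dist_mx_mul mulmxDr -!scalemxAr [X in _ + _ *: X]dual_idem_dist_mx_eq0.
  by rewrite scaler0 addr0.
lia.
Qed.

Hypothesis sum_v : \sum_r v r 0 = 0.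

(** For [y] on level [i + 2], each vertex of level 2 is at distance [i], [i + 2] or
    [i + 4] from [y], so that every entry of the total on that level is the sum of
    the entries of [v]. *)
Lemma level_sum i :
  w_ e x v i + E i.+2 *m (Ad i.+2 *m v) + E i.+2 *m (Ad i.+4 *m v) = 0.
Proof.
apply/matrixP => r s; rewrite (ord1 s) /w_ [LHS]mxE [X in X + _]mxE.
rewrite !dual_idem_mulE [RHS]mxE -!mulrDr.
have [lev_r|] := eqVneq; rewrite ?mul0r // mul1r !mxE -!big_split /=.
rewrite -[RHS]sum_v; apply: eq_bigr => l _.
rewrite !mxE -!mulrDl -!natrD.
have -> : v l 0 = (lev l == 2)%:R * v l 0 by rewrite -{1}Ev dual_idem_mulE.
have [lev_l|_] := eqVneq (lev l) 2%N; rewrite ?mul0r ?mulr0 // mul1r.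
have -> : ((dist e (enum_val r) (enum_val l) == i) +
  (dist e (enum_val r) (enum_val l) == i.+2) +
  (dist e (enum_val r) (enum_val l) == i.+4) = 1)%N.
  have := dist_to_level2 (enum_val r) lev_l; rewrite lev_r.
  lia.
by rewrite mul1r.
Qed.

End Level2.

Lemma dual_idem_w v i : E i.+2 *m w_ e x v i = w_ e x v i.
Proof. by rewrite dual_idem_mul eqxx. Qed.

(** As [A] is real symmetric, [a y^* y = y^* A z = (A y)^* z], and the last product
    only involves level [i] of [A y]. *)
Lemma raised_not_lowered_eq0 (y z : V) i a :
  a != 0 -> E i.+1 *m y = y -> E i *m z = z ->
  E i.+1 *m (A *m z) = a *: y -> E i *m (A *m y) = 0 -> y = 0.
Proof.
move=> a0 Ey Ez up down.
have E_tr j : (E j)^T = E j.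
  apply/matrixP => r s; rewrite !mxE eq_sym.
  by have [->|] := eqVneq; rewrite ?eqxx.
pose ys := (map_mx Num.conj y)^T.
have E_conj j : map_mx Num.conj (E j) = E j.
  by apply/matrixP => r s; rewrite !mxE conjC_nat.
have A_conj : map_mx Num.conj A = A.
  by apply/matrixP => r s; rewrite !mxE conjC_nat.
have ysE : ys *m E i.+1 = ys.
  by rewrite /ys -[in LHS]E_tr -trmx_mul -[in LHS]E_conj -map_mxM Ey.
have ysA : ys *m A *m E i = 0.
  have -> : ys *m A *m E i = (map_mx Num.conj (E i *m (A *m y)))^T.
    by rewrite !map_mxM E_conj A_conj !trmx_mul E_tr dist_mx_tr.
  by rewrite down map_mx0 trmx0.
have : ys *m (a *: y) = 0.
  by rewrite -up !mulmxA ysE -Ez mulmxA ysA mul0mx.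
rewrite -scalemxAr => /eqP; rewrite scaler_eq0 (negPf a0) /= => /eqP yy0.
have := congr1 (fun M : 'M_1 => M 0 0) yy0; rewrite mxE [RHS]mxE => sum0.
apply/matrixP => r s; rewrite ord1 [RHS]mxE; apply/eqP.
rewrite -normr_eq0 -sqrf_eq0 normCK; apply/eqP.
have := @psumr_eq0P C 'I_N xpredT (fun r => y r 0 * Num.conj (y r 0)).
move=> /(_ _ _ r isT) -> //; first by move=> l _; apply: mul_conjC_ge0.
by rewrite -[RHS]sum0; apply: eq_bigr => l _; rewrite !mxE mulrC.
Qed.

(** * Modules for the Terwilliger algebra *)

Variable W : {vspace V}.
Hypothesis W_T : T_module e x W.

Lemma terwilliger_dual j : terwilliger e x (E j).
Proof.
have [le_j|lt_j] := leqP j D; first exact: terw_dual.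
by rewrite dual_idem_far // -(scale0r 1%:M); apply/terw_scale/terw_one.
Qed.

Lemma terwilliger_dist_mx j : terwilliger e x (Ad j).
Proof.
have [m] := ubnP j; elim: m j => // m IH [|[|j]] lt_m.
- by rewrite dist_mx0 //; apply: terw_one.
- exact: terw_adj.
have [le_j|lt_j] := leqP j.+2 D; last first.
  by rewrite dist_mx_far // -(scale0r 1%:M); apply/terw_scale/terw_one.
have cn0 : (c_ e j.+2)%:R != 0 :> C by rewrite pnatr_eq0 -lt0n c_gt0.
have -> : Ad j.+2 = (c_ e j.+2)%:R^-1 *: (A *m Ad j.+1 + - (b_ e j)%:R *: Ad j).
  by rewrite adj_mul_dist_mx // scaleNr [X in X - _]addrC addrK scalerA mulVf // scale1r.
apply/terw_scale/terw_add; first by apply: terw_mul; [apply: terw_adj | apply: IH].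
by apply/terw_scale/IH/ltnW.
Qed.

Lemma dual_idem_stable j u : u \in W -> E j *m u \in W.
Proof. exact/W_T/terwilliger_dual. Qed.

Lemma dist_mx_stable j u : u \in W -> Ad j *m u \in W.
Proof. exact/W_T/terwilliger_dist_mx. Qed.

Lemma mem_dual_img j u : u \in W -> E j *m u \in dual_img e x j W.
Proof.
by move=> uW; rewrite -[E j *m u](lfunE (mulmx (E j))); apply: memv_img.
Qed.

Lemma dual_imgP j u : u \in dual_img e x j W -> u \in W /\ E j *m u = u.
Proof.
case/memv_imgP => w wW ->; rewrite lfunE /=; split; first exact: dual_idem_stable.
by rewrite dual_idem_mul eqxx.
Qed.

Lemma below_endpoint j u : (j < endpoint e x W)%N -> (j <= D)%N -> u \in W -> E j *m u = 0.
Proof.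
move=> lt_j le_j uW; have := before_find 0 lt_j.
rewrite nth_iota // add0n => /negbFE/eqP W0.
by apply/eqP; rewrite -memv0 -W0 mem_dual_img.
Qed.

Lemma thin_line j u u' : thin e x W -> u \in W -> u' \in W -> E j *m u != 0 ->
  exists a, E j *m u' = a *: (E j *m u).
Proof.
move=> W_thin uW uW' nz.
have [le_j|lt_j] := leqP j D; last by rewrite dual_idem_far // mul0mx eqxx in nz.
apply/vlineP; suff -> : <[E j *m u]>%VS = dual_img e x j W by apply: mem_dual_img.
apply/eqP; rewrite eqEdim -memvE mem_dual_img // dim_vline nz.
exact: W_thin.
Qed.

(** * Thin irreducible modules of endpoint 2 *)

Section Endpoint2.

Hypothesis D_ge4 : (4 <= D)%N.
Hypothesis W_thin : thin e x W.
Hypothesis W_endpoint : endpoint e x W = 2%N.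
Variable v : V.
Hypothesis v_in : v \in dual_img e x 2 W.
Hypothesis v_neq0 : v != 0.
Local Notation w := (w_ e x v).

Let vW : v \in W. Proof. by case: (dual_imgP v_in). Qed.
Let Ev : E 2 *m v = v. Proof. by case: (dual_imgP v_in). Qed.

(** The sum is entry [x] of [A_2 v], and [E_0] annihilates [W]. *)
Lemma sum_level2_eq0 : \sum_r v r 0 = 0.
Proof.
have := @below_endpoint 0 (Ad 2 *m v); rewrite W_endpoint dist_mx_stable // => /(_ isT isT isT).
move/matrixP/(_ (enum_rank x) 0); rewrite dual_idem_mulE enum_rankK distxx // mul1r.
rewrite [RHS]mxE mxE => s0; rewrite -[RHS]s0; apply: eq_bigr => r _.
by rewrite mxE enum_rankK -{1 2}Ev dual_idem_mulE mulrA -natrM mulnb andbb.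
Qed.

Variable t : R.
Hypothesis W_local : has_local_eigenvalue e x W (theta_tilde e t)%:C.
Hypothesis p_neq0 : forall i, (i < D.-1)%N -> (p_ e R i).[t] != 0.
Hypothesis p_root : (p_ e R D.-1).[t] = 0.

Lemma w_in_module i : w i \in W. Proof. by apply/dual_idem_stable/dist_mx_stable. Qed.

(** The three claims are carried together: [omega_{i+1}] is nonzero, so the third
    claim at [i] gives the first at [i + 1]; thinness and [outer_recurrence] then
    give the second, and [middle_recurrence] the third. *)
Lemma w_chain i : (i.+4 <= D)%N ->
  [/\ w i != 0,
      E i.+2 *m (Ad i.+2 *m v) = (outer_coef e t i - 1)%:C *: w i &
      E i.+2 *m (A *m w i.+1) = (omega e t i.+1)%:C *: w i].
Proof.
elim: i => [_|i IH lt_i].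
  have D3 : (2 < D)%N by apply: leq_trans D_ge4.
  have p1 : (p_ e R 1).[t] != 0 by apply: p_neq0; lia.
  have p2 : (p_ e R 2).[t] != 0 by apply: p_neq0; lia.
  have w0 : w 0 = v by rewrite /w_ dist_mx0 // mul1mx.
  have Z2 : E 2 *m (Ad 2 *m v) = (outer_coef e t 0 - 1)%:C *: w 0.
    rewrite w0 -(theta_tilde_outer_coef (@b_add_c) (@c_gt0) c_at1) //; have := W_local v_in.
    by rewrite -!mulmxA Ev.
  split=> //; first by rewrite w0.
  have := middle_recurrence v 0.
  have -> : E 1 *m (Ad 1 *m v) = 0.
    by apply: below_endpoint; rewrite ?W_endpoint ?dist_mx_stable.
  rewrite !mulmx0 addr0 Z2 => ->.
  rewrite (omega1_outer_coef (@b_add_c) (@c_gt0) c_at1) //; move: (outer_coef e t 0 - 1) => g.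
  by rewrite rmorphD rmorphM !rmorph_nat scalerA -scalerDl.
have [wi Zi Li] := IH (ltnW lt_i).
have p0 : (p_ e R i).[t] != 0 by apply: p_neq0; lia.
have p1 : (p_ e R i.+1).[t] != 0 by apply: p_neq0; lia.
have p2 : (p_ e R i.+2).[t] != 0 by apply: p_neq0; lia.
have p3 : (p_ e R i.+3).[t] != 0 by apply: p_neq0; lia.
have lt3 : (i.+3 < D)%N by apply: ltnW.
have om : omega e t i.+1 != 0.
  exact: (omega_neq0 (@c_gt0) (@b_gt0) (ltnW lt3)).
have wi1 : w i.+1 != 0.
  apply/eqP => w0; have := Li; rewrite w0 !mulmx0 => /esym/eqP.
  by rewrite scaler_eq0 fmorph_eq0 (negPf om) (negPf wi).
have [beta Zb] : exists a, E i.+3 *m (Ad i.+3 *m v) = a *: w i.+1.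
  by apply: thin_line => //; apply: dist_mx_stable.
have Mb : E i.+3 *m (Ad i.+4.+1 *m v) = - (1 + beta) *: w i.+1.
  have := level_sum Ev sum_level2_eq0 i.+1; rewrite Zb => /eqP.
  by rewrite addrC addr_eq0 scaleNr scalerDl scale1r => /eqP.
have Mi : E i.+2 *m (Ad i.+4 *m v) = - (outer_coef e t i)%:C *: w i.
  have := level_sum Ev sum_level2_eq0 i; rewrite Zi => /eqP.
  rewrite addrC addr_eq0 => /eqP->.
  by rewrite scaleNr rmorphB scalerBl scale1r addrC subrK.
have betaE : beta = (outer_coef e t i.+1 - 1)%:C.
  have := outer_recurrence Ev i.
  rewrite Mb Mi -!scalemxAr Li !scalerA => /eqP.
  rewrite -subr_eq0 -scalerBl scaler_eq0 (negPf wi) orbF subr_eq0 !mulNr mulrN eqr_opp.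
  have -> : (b_ e i.+4)%:R * (outer_coef e t i)%:C
      = (outer_coef e t i.+1)%:C * (omega e t i.+1)%:C.
    have := outer_coef_omega (@c_gt0) lt3 p1 p2 p3.
    move: (omega e t i.+1) (outer_coef e t i.+1) (outer_coef e t i) => o g1 g0.
    move/(congr1 (real_complex R)).
    by rewrite !rmorphM rmorph_nat => ->.
  move/eqP/mulIf; rewrite fmorph_eq0 => /(_ om).
  move: (outer_coef e t i.+1) => g eq_g.
  by rewrite rmorphB rmorph1 /= -eq_g [1 + _]addrC addrK.
rewrite betaE in Zb; split=> //.
have := middle_recurrence v i.+1.
rewrite Zb Zi -!scalemxAr raise_w // !scalerA -scalerDl => /eqP.
rewrite eq_sym -subr_eq -scalerBl => /eqP <-.
rewrite (omega_outer_coef (@b_add_c) (@c_gt0) lt3 p1 p2 p3).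
move: (outer_coef e t i.+1 - 1) (outer_coef e t i - 1) => g1 g0.
by rewrite rmorphB rmorphD !rmorphM !rmorph_nat [_ * _%:R]mulrC.
Qed.

(** The formula for [omega_{D-3}] contains the factor [p_{D-1}], so [w_{D-3}] is a
    raised vector that lowers to 0. *)
Lemma w_last : w (D - 3) = 0.
Proof.
have [m DE] : exists m, D = m.+4 by exists (D - 4)%N; lia.
have -> : (D - 3)%N = m.+1 by lia.
have le_m : (m.+4 <= D)%N by rewrite DE.
have [_ _ Lm] := w_chain le_m.
have om0 : omega e t m.+1 = 0.
  by rewrite /omega /= -[m.+3]/(m.+4.-1) -DE p_root mulr0 mul0r mulr0.
apply: (raised_not_lowered_eq0 (z := w m) (i := m.+2) (a := (c_ e m.+1)%:R)).
- by rewrite pnatr_eq0 -lt0n c_gt0 // DE /=; lia.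
- exact: dual_idem_w.
- exact: dual_idem_w.
- exact: raise_w.
- by rewrite Lm om0 scale0r.
Qed.

Local Notation ws := (w_tuple e x (D - 3) v).

Lemma adj_w i : (i.+4 <= D)%N ->
  A *m w i = (if i is j.+1 then (omega e t i)%:C *: w j else 0)
           + (c_ e i.+1)%:R *: w i.+1.
Proof.
move=> lt_i; rewrite [LHS](adj_split (j := i.+1)) ?dual_idem_w //.
rewrite raise_w //; congr (_ + _).
case: i lt_i => [|i] lt_i; last first.
  by have [_ _ ->] := w_chain (ltnW lt_i).
apply: below_endpoint; rewrite ?W_endpoint //.
by apply: W_T; [apply: terw_adj | apply: w_in_module].
Qed.

Lemma span_w_stable : T_module e x <<ws>>%VS.
Proof.
have mem_ws i : w i \in <<ws>>%VS \/ (D - 3 < i)%N.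
  have [lt_i|] := ltnP i (D - 3).
    by left; apply/memv_span/mapP; exists (Ordinal lt_i); rewrite // mem_enum.
  rewrite leq_eqVlt => /predU1P[<-|]; last by right.
  by left; rewrite w_last mem0v.
have stab B : (forall j, (j < D - 3)%N -> B *m w j \in <<ws>>%VS) ->
    forall u, u \in <<ws>>%VS -> B *m u \in <<ws>>%VS.
  move=> Bw u uU; rewrite -[B *m u](lfunE (mulmx B)).
  have : (linfun (mulmx B) @: <<ws>> <= <<ws>>)%VS.
    rewrite limg_span; apply/span_subvP => _ /mapP[_ /mapP[j _ ->] ->].
    by rewrite lfunE /= Bw.
  by move/subvP; apply; apply: memv_img.
move=> B; elim=> {B} [|j _||B1 B2 _ IH1 _ IH2|a B _ IH|B1 B2 _ IH1 _ IH2].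
- apply: stab => j lt_j; rewrite adj_w; last by lia.
  apply: memvD; last by apply: memvZ; have [] // := mem_ws j.+1; lia.
  case: j lt_j => [|j] lt_j; first exact: mem0v.
  by apply: memvZ; have [] // := mem_ws j; lia.
- apply: stab => l lt_l; rewrite dual_idem_mul; case: ifP => _; last exact: mem0v.
  by have [] // := mem_ws l; lia.
- by move=> u uU; rewrite mul1mx.
- by move=> u uU; rewrite mulmxDl memvD ?IH1 ?IH2.
- by move=> u uU; rewrite -scalemxAl memvZ ?IH.
- by move=> u uU; rewrite -mulmxA IH1 ?IH2.
Qed.

(** The vectors are nonzero and lie on distinct levels. *)
Lemma w_free : free ws.
Proof.
apply/freeP => a sum0 j.
have lt_j : (j.+4 <= D)%N by have := ltn_ord j; lia.
have [wj _ _] := w_chain lt_j.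
have wsE (l : 'I_(D - 3)) : ws`_l = w l by rewrite -tnth_nth tnth_mktuple.
have : E j.+2 *m (\sum_(l < D - 3) a l *: ws`_l) = a j *: w j.
  have others l : l != j -> E j.+2 *m (a l *: ws`_l) = 0.
    move=> /negPf ne_lj; rewrite -scalemxAr wsE dual_idem_mul !eqSS eq_sym.
    by rewrite val_eqE ne_lj scaler0.
  rewrite mulmx_sumr (bigD1 j) // (eq_bigr _ others) big1_eq wsE /= addr0.
  by rewrite -scalemxAr dual_idem_w.
by rewrite sum0 mulmx0 => /esym/eqP; rewrite scaler_eq0 (negPf wj) orbF => /eqP.
Qed.

Hypothesis W_min : forall U : {vspace V},
  T_module e x U -> (U <= W)%VS -> U = 0%VS \/ U = W.

Lemma w_basis : basis_of W ws.
Proof.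
rewrite /basis_of w_free andbT; have sub : (<<ws>> <= W)%VS.
  by apply/span_subvP => _ /mapP[j _ ->]; apply: w_in_module.
have [U0|->] := W_min span_w_stable sub; last exact: eqxx.
have lt0 : (0 < D - 3)%N by lia.
have : ws`_0 \in <<ws>>%VS by apply/memv_span/mem_nth; rewrite size_tuple.
rewrite -(tnth_nth 0 ws (Ordinal lt0)) tnth_mktuple U0 memv0.
by rewrite /w_ dist_mx0 // mul1mx Ev (negPf v_neq0).
Qed.

Lemma w_represents : represents W ws A (tridiag_mx e (D - 3) t).
Proof.
split; first exact: w_basis.
move=> j; rewrite tnth_mktuple adj_w; last by have := ltn_ord j; lia.
have -> : \sum_(i < D - 3) tridiag_mx e (D - 3) t i j *: tnth ws i
  = \sum_(i < D - 3) (if i == j.+1 :> nat then (c_ e j.+1)%:R *: w i else 0)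
  + \sum_(i < D - 3) (if j == i.+1 :> nat then (omega e t j)%:C *: w i else 0).
  rewrite -big_split; apply: eq_bigr => i _ /=; rewrite mxE tnth_mktuple.
  have [->|_] := eqVneq (i : nat) j.+1; first by rewrite ltn_eqF ?addr0 // ltnW.
  by rewrite add0r; case: eqP; rewrite ?scale0r.
rewrite addrC; congr (_ + _).
  rewrite (sum_ord_eq _ _ (fun i => (c_ e j.+1)%:R *: w i)).
  case: ltnP => // ge_j.
  have -> : j.+1 = (D - 3)%N by apply/eqP; rewrite eqn_leq ltn_ord.
  by rewrite w_last scaler0.
case: (j : nat) (ltn_ord j) => [|l] lt_l; first by rewrite big1.
under eq_bigr => i _ do rewrite eqSS eq_sym.
by rewrite (sum_ord_eq _ _ (fun i => (omega e t l.+1)%:C *: w i)) ltnW.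
Qed.

End Endpoint2.

End Graph.

Theorem theorem13p6 (R : realType) (X : finType) (e : rel X)
  (D : nat) (theta : nat -> R) (x : X) (n : nat)
  (W : {vspace 'cV[R[i]]_#|X|}) (v : 'cV[R[i]]_#|X|)
  (e_simple : simple_graph e) (e_conn : connected e)
  (e_dr : distance_regular e) (e_bip : bipartite e)
  (diamD : diameter e = D) (D_ge4 : (4 <= D)%N)
  (k_ge3 : (3 <= valency e)%N)
  (theta_eig : ordered_eigenvalues e theta)
  (n_choice : n = 1%N \/ odd D /\ n = D./2)
  (W_irr : irreducible_T_module e x W)
  (W_thin : thin e x W)
  (W_endpoint : endpoint e x W = 2%N)
  (W_local : has_local_eigenvalue e x W (theta_tilde e (theta n))%:C)
  (v_in : v \in dual_img e x 2 W) (v_neq0 : v != 0) :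
  (forall i : nat, (1 <= i)%N -> (i <= D - 4)%N ->
     (c_ e i)%:R != 0 :> R /\
     (p_ e R i).[theta n] * (p_ e R i.+1).[theta n] != 0) /\
  represents W (w_tuple e x (D - 3) v) (adj_mx e R)
    (tridiag_mx e (D - 3) (theta n)).
Proof.
have [e_sym e_irr] := e_simple; subst D.
have [theta_decr theta_spec] := theta_eig.
have D_gt0 : (0 < diameter e)%N by lia.
have D_gt1 : (1 < diameter e)%N by lia.
have bc_sum i : (i <= diameter e)%N -> (b_ e i + c_ e i = valency e)%N.
  exact: b_add_c.
have c_pos i : (0 < i <= diameter e)%N -> (0 < c_ e i)%N by apply: c_gt0.
have b_pos i : (i < diameter e)%N -> (0 < b_ e i)%N by apply: b_gt0.
have b_last : b_ e (diameter e) = 0%N by apply: b_diam.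
have c_one : c_ e 1 = 1%N by apply: c_at1.
have k_ge1 : 1 <= (valency e)%:R :> R by rewrite ler1n; lia.
have theta_root i : (i <= diameter e)%N -> theta i != (valency e)%:R ->
    (p_ e R (diameter e)).[theta i] + (p_ e R (diameter e).-1).[theta i] = 0.
  move=> le_i; apply: eigenvalue_p_root => //.
  by apply/theta_spec; exists i.
have n_range : (0 < n < diameter e)%N.
  by case: n_choice => [->|[_ ->]]; lia.
have p_root : (p_ e R (diameter e).-1).[theta n] = 0.
  exact: theta_root_pred.
have p_neq0 i : (i < (diameter e).-1)%N -> (p_ e R i).[theta n] != 0.
  case: n_choice => [->|[oddD ->]] lt_i.
    exact: (p_theta1_neq0 (D := diameter e)).
  exact: (p_theta_half_neq0 (D := diameter e)).
have [W_T _ W_min] := W_irr.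
split; last exact: w_represents.
move=> i i_gt0 le_i; split; first by rewrite pnatr_eq0 -lt0n c_pos // i_gt0 /=; lia.
by rewrite mulf_neq0 // p_neq0 //; lia.
Qed.
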